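(* For every nonnegative integer $\ell$, every nonnegative integer $n$ and every complex number $x$, $$\sum_{k=0}^n (q^{-3n};q^3)_k \left[\begin{matrix} x,\ q^{-\ell}/x\\ q,\ -1,\ q^{1/2-\ell},\ -q^{1/2},\ q^{-3n}\end{matrix}\middle| q\right]_k q^k = \left[\begin{matrix} qx,\ q^{1/2}x\\ qx^2,\ q^{1/2}\end{matrix}\middle|q\right]_\ell \sum_{i=0}^{\ell} q^{(\ell+\frac12)i}\,\frac{1+xq^{i}}{2(1+x)}\left[\begin{matrix} q^{-\ell},\ x^2\\ q,\ x^2q^{\ell+1}\end{matrix}\middle|q\right]_i\left\{\left[\begin{matrix} q^{1+i}x,\ q^{2-i}/x\\ q,\ q^2\end{matrix}\middle|q^3\right]_n+\left[\begin{matrix} q^{2+i}x,\ q^{1-i}/x\\ q,\ q^2\end{matrix}\middle|q^3\right]_n\right\}.$$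
   Context: $q$ is a complex number with a fixed square root $q^{1/2}$, and $q^{r/2}$ means $(q^{1/2})^r$. For a complex number $a$, a base $p$ and a nonnegative integer $m$, $(a;p)_m=\prod_{j=0}^{m-1}(1-ap^j)$ with $(a;p)_0=1$. The bracket notation means $\left[\begin{matrix} a_1,\dots,a_r\\ b_1,\dots,b_s\end{matrix}\middle|p\right]_m=\frac{(a_1;p)_m\cdots(a_r;p)_m}{(b_1;p)_m\cdots(b_s;p)_m}$ (used with $p=q$ and $p=q^3$). The identity is understood for values of the parameters for which no denominator vanishes. *)

(* Defs.v *)
From mathcomp Require Import all_boot all_order all_algebra.
From mathcomp Require Export reals complex.

Set Implicit Arguments.
Unset Strict Implicit.
Unset Printing Implicit Defensive.

Import GRing.Theory.
Local Open Scope ring_scope.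

Definition qpoch (F : fieldType) (a p : F) (m : nat) : F :=
  \prod_(0 <= j < m) (1 - a * p ^+ j).

Definition qpochs (F : fieldType) (s : seq F) (p : F) (m : nat) : F :=
  \prod_(a <- s) qpoch a p m.

(* [ as ; bs | p ]_m; it has its mathematical meaning only when
   qpochs bs p m != 0. *)
Definition qbracket (F : fieldType) (s t : seq F) (p : F) (m : nat) : F :=
  qpochs s p m / qpochs t p m.

(* Main.v *)
Require Import Defs.
From mathcomp Require Import all_boot all_order all_algebra.
From mathcomp Require Import reals complex.
From mathcomp Require Import ring zify.

(* Put q = sq^2, S(x) = sum_k q^(k^2) (1 + q^k) G(n,k) (x; q)_k (1/x; q)_k with
   G(n,k) = [3n-k choose 2k]_q (q, q^2; q^3)_{n-k}.  Two facts give the theorem.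

   (1) S(x) = (qx, q^2/x; q^3)_n + (q^2 x, q/x; q^3)_n.  It follows from
   (qx, q^2/x; q^3)_n = sum_k q^(k^2) G(n,k) (x, q/x; q)_k, which is proved by
   induction on n, and from its image under x -> 1/x.

   (2) (x, q^-l/x; q)_k is a combination, with coefficients independent of k up
   to a common factor, of the products (x q^i, q^-i/x; q)_k, 0 <= i <= l.  This
   is a terminating very-well-poised 6phi5 sum.  Its coefficients are those of
   a divided difference over the nodes x q^i + q^-i/x, so that the sum of order
   l + 1 at x is a combination of the sums of order l at x and at x q.

   Expanding every term of the left-hand side by (2) and summing over k by (1)
   at x q^i gives the right-hand side.  All identities in which q could be a
   root of unity are kept free of divisions. *)

Set Implicit Arguments.
Unset Strict Implicit.
Unset Printing Implicit Defensive.

Import GRing.Theory.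
Local Open Scope ring_scope.

(** * Finite q-Pochhammer symbols *)

Section QPochhammer.
Variable F : fieldType.
Implicit Types (a p q s x : F) (k l m n i : nat).

Lemma qpoch0 a p : qpoch a p 0 = 1.
Proof. by rewrite /qpoch big_geq. Qed.

Lemma qpochS a p m : qpoch a p m.+1 = qpoch a p m * (1 - a * p ^+ m).
Proof. by rewrite /qpoch big_nat_recr. Qed.

Lemma qpochSl a p m : qpoch a p m.+1 = (1 - a) * qpoch (a * p) p m.
Proof.
rewrite /qpoch big_nat_recl //= expr0 mulr1; congr (_ * _).
by apply: eq_bigr => j _; rewrite exprS mulrA.
Qed.

Lemma qpoch_shift a p m :
  qpoch a p m * (1 - a * p ^+ m) = (1 - a) * qpoch (a * p) p m.
Proof. by rewrite -qpochS qpochSl. Qed.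

Lemma qpochs2 a b p m : qpochs [:: a; b] p m = qpoch a p m * qpoch b p m.
Proof. by rewrite /qpochs !big_cons big_nil mulr1. Qed.

Lemma qpoch_neq0 a p m j : qpoch a p m != 0 -> (j < m)%N -> 1 - a * p ^+ j != 0.
Proof.
rewrite /qpoch prodf_seq_neq0 => /allP H jm.
by apply: (H j); rewrite mem_index_iota.
Qed.

Lemma qpoch_neq0P a p m :
  (forall j, (j < m)%N -> 1 - a * p ^+ j != 0) -> qpoch a p m != 0.
Proof.
move=> H; rewrite /qpoch prodf_seq_neq0; apply/allP => j.
by rewrite mem_index_iota => jm; apply/implyP => _; apply: H.
Qed.

(** With q = s^2, (q, -q; q)_k = (q^2; q^2)_k and (s, -s; q)_k = (q; q^2)_k interlace into (q;
    q)_{2k}. The factor 1 + q^k turns (-1; q)_k into 2 (-q; q)_k. *)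
Lemma qpoch_double s k :
  qpoch (s ^+ 2) (s ^+ 2) k * qpoch (-1) (s ^+ 2) k * qpoch (- s) (s ^+ 2) k *
    qpoch s (s ^+ 2) k * (1 + s ^+ 2 ^+ k)
  = 2 * qpoch (s ^+ 2) (s ^+ 2) (2 * k).
Proof.
have shift : qpoch (-1) (s ^+ 2) k * (1 + s ^+ 2 ^+ k) =
    2 * qpoch (- s ^+ 2) (s ^+ 2) k.
  have := qpoch_shift (-1) (s ^+ 2) k.
  by rewrite !mulN1r !opprK.
transitivity (2 * (qpoch (s ^+ 2) (s ^+ 2) k * qpoch (- s ^+ 2) (s ^+ 2) k
    * qpoch (- s) (s ^+ 2) k * qpoch s (s ^+ 2) k)).
  rewrite [in RHS](_ : 2 * _ = qpoch (s ^+ 2) (s ^+ 2) k *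
    (2 * qpoch (- s ^+ 2) (s ^+ 2) k) * qpoch (- s) (s ^+ 2) k
    * qpoch s (s ^+ 2) k); last by ring.
  by rewrite -shift; ring.
congr (_ * _); elim: k {shift} => [|k IH]; first by rewrite muln0 !qpoch0 !mulr1.
rewrite (_ : (2 * k.+1 = (2 * k).+2)%N); last by lia.
rewrite !qpochS -IH [_ ^+ (2 * k).+1]exprSr (mulnC 2 k) exprM.
by move: ((s ^+ 2) ^+ k) => w; ring.
Qed.

(** * Expansion of products in base q^3 by products in base q *)

(** Since 3n - k = 3m + 3 + 2k, both sides are the product of 1 - q^j over 3m + 1 <= j <= 3m + 3 +
    2k. *)
Lemma qpoch_triple q n k m : (n - k = m.+1)%N ->
  qpoch (q ^+ (3 * m).+1) q (2 * k).+2 * (1 - q ^+ (3 * n - k))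
  = (1 - q ^+ (3 * m).+1) * (1 - q ^+ (3 * m).+2) * (1 - q ^+ (3 * m.+1))
    * qpoch (q ^+ (3 * m.+1).+1) q (2 * k).
Proof.
move=> Em.
have -> : q ^+ (3 * n - k) = q ^+ (3 * m).+1 * q ^+ (2 * k).+2.
  by rewrite -exprD; congr (_ ^+ _); lia.
rewrite -qpochS !qpochSl -!exprSr.
have -> : (3 * m.+1 = (3 * m).+3)%N by lia.
by rewrite !mulrA.
Qed.

(* Equal to [3n-k choose 2k]_q (q; q^3)_{n-k} (q^2; q^3)_{n-k} for k <= n, but
   free of divisions, hence meaningful when q is a root of unity. *)
Fixpoint cubic_coef q n k : F :=
  match n, k with
  | 0, _ => (k == 0)%:R
  | m.+1, 0 => (1 - q ^+ (3 * m).+1) * (1 - q ^+ (3 * m).+2) * cubic_coef q m 0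
  | m.+1, j.+1 =>
      (1 - q ^+ (3 * m - j)) * (1 - q ^+ (3 * m + 3 + j)) * cubic_coef q m j.+1
      + q ^+ (3 * (m - j)) * cubic_coef q m j
  end.

Lemma cubic_coef_gt q n k : (n < k)%N -> cubic_coef q n k = 0.
Proof.
elim: n k => [|n IH] [|k] //= nk.
by rewrite !IH ?mulr0 ?addr0 //; lia.
Qed.

(** Clearing (q; q)_{2k} makes both terms of the recursion explicit multiples of one product,
    leaving a polynomial identity. *)
Lemma cubic_coefE q n k : (k <= n)%N ->
  qpoch q q (2 * k) * cubic_coef q n k
  = qpoch q (q ^+ 3) (n - k) * qpoch (q ^+ 2) (q ^+ 3) (n - k)
    * qpoch (q ^+ (3 * (n - k)).+1) q (2 * k).
Proof.
elim: n k => [|n IH] [|k] //= kn.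
- by rewrite muln0 !qpoch0 !mulr1.
- have := IH 0 (leq0n _); rewrite muln0 !qpoch0 !subn0 mulr1 !mul1r => ->.
  by rewrite mulr1 !qpochS -!exprM !exprS; ring.
have {}kn : (k <= n)%N by [].
rewrite subSS mulrDr.
have -> : (2 * k.+1 = (2 * k).+2)%N by lia.
have E2 : q ^+ (3 * n + 3 + k) = q ^+ (3 * (n - k)) * q ^+ (2 * k) ^+ 2 * q ^+ 3.
  by rewrite -exprM -!exprD; congr (_ ^+ _); lia.
have first_term : qpoch q q (2 * k).+2 *
    ((1 - q ^+ (3 * n - k)) * (1 - q ^+ (3 * n + 3 + k)) * cubic_coef q n k.+1)
  = (1 - q ^+ (3 * (n - k))) * (1 - q ^+ (3 * n + 3 + k)) *
    (qpoch q (q ^+ 3) (n - k) * qpoch (q ^+ 2) (q ^+ 3) (n - k)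
    * qpoch (q ^+ (3 * (n - k)).+1) q (2 * k)).
  (* For k = n both sides vanish, the right one through 1 - q^0. *)
  have [ltkn|lenk] := ltnP k n; last first.
    have -> : (n - k = 0)%N by lia.
    by rewrite cubic_coef_gt ?ltnS // muln0 expr0 subrr !(mulr0, mul0r).
  have := IH k.+1 ltkn; rewrite (_ : (2 * k.+1 = (2 * k).+2)%N); last by lia.
  have [m Em] : exists m, (n - k = m.+1)%N by exists (n - k).-1; lia.
  rewrite (_ : (n - k.+1 = m)%N) ?Em; last by lia.
  rewrite !mulrA => E.
  rewrite [LHS](_ : _ = qpoch q q (2 * k).+2 * cubic_coef q n k.+1 *
    ((1 - q ^+ (3 * n - k)) * (1 - q ^+ (3 * n + 3 + k)))); last by ring.
  rewrite E.
  have T := qpoch_triple q Em.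
  rewrite [LHS](_ : _ = qpoch q (q ^+ 3) m * qpoch (q ^+ 2) (q ^+ 3) m *
    (qpoch (q ^+ (3 * m).+1) q (2 * k).+2 * (1 - q ^+ (3 * n - k))) *
    (1 - q ^+ (3 * n + 3 + k))); last by ring.
  rewrite T !qpochS -!exprM.
  by rewrite !exprS; ring.
rewrite first_term E2.
rewrite [X in _ + X](_ : _ = q ^+ (3 * (n - k)) * (1 - q * q ^+ (2 * k))
  * (1 - q * q ^+ (2 * k).+1) * (qpoch q q (2 * k) * cubic_coef q n k)); last first.
  by rewrite !qpochS; ring.
rewrite IH // !qpochS !exprS; ring.
Qed.

(** In the induction on n the new factor splits as (1 - q^(3n+1) x)(1 - q^(3n+2)/x) = (1 -
    q^(3n+1-k))(1 - q^(3n+2+k)) + q^(3n+1-k) (1 - x q^k)(1 - q^(k+1)/x). The first part keeps k and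
    the second raises it, which is the recursion defining [cubic_coef]. *)
Lemma cubic_expansion q x n : x != 0 ->
  qpoch (q * x) (q ^+ 3) n * qpoch (q ^+ 2 / x) (q ^+ 3) n
  = \sum_(0 <= k < n.+1)
      q ^+ (k ^ 2) * cubic_coef q n k * (qpoch x q k * qpoch (q / x) q k).
Proof.
move=> x0; elim: n => [|n IH].
  by rewrite big_nat1 !qpoch0 !mulr1.
set W := fun k => qpoch x q k * qpoch (q / x) q k.
rewrite !qpochS mulrACA IH mulr_suml.
have step k : (k <= n)%N ->
   q ^+ (k ^ 2) * cubic_coef q n k * W k *
     ((1 - q * x * q ^+ 3 ^+ n) * (1 - q ^+ 2 / x * q ^+ 3 ^+ n))
   = q ^+ (k ^ 2) * cubic_coef q n k * W k *
      ((1 - q ^+ ((3 * n).+1 - k)) * (1 - q ^+ ((3 * n).+2 + k)))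
   + q ^+ (k.+1 ^ 2) * (q ^+ (3 * (n - k)) * cubic_coef q n k) * W k.+1.
  move=> kn; rewrite /W !qpochS -exprM.
  have -> : ((3 * n).+1 - k = (3 * (n - k) + k + k).+1)%N by lia.
  have -> : (3 * n = 3 * (n - k) + k + k + k)%N by lia.
  have -> : (k.+1 ^ 2 = (k ^ 2 + k + k).+1)%N by lia.
  rewrite addSn !exprS !exprD.
  by field.
rewrite (eq_big_nat _ _ (F2 := fun k => q ^+ (k ^ 2) * cubic_coef q n k * W k *
      ((1 - q ^+ ((3 * n).+1 - k)) * (1 - q ^+ ((3 * n).+2 + k)))
   + q ^+ (k.+1 ^ 2) * (q ^+ (3 * (n - k)) * cubic_coef q n k) * W k.+1)); last first.
  by move=> k /andP[_ kn]; apply: step.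
rewrite big_split /= [in RHS]big_nat_recl //.
(* A zero term at k = n + 1 extends the first family to the range of the goal. *)
rewrite (_ : \sum_(0 <= k < n.+1) _ = \sum_(0 <= k < n.+2)
   q ^+ (k ^ 2) * cubic_coef q n k * W k *
      ((1 - q ^+ ((3 * n).+1 - k)) * (1 - q ^+ ((3 * n).+2 + k)))); last first.
  by rewrite [RHS]big_nat_recr //= cubic_coef_gt // mulr0 !mul0r addr0.
rewrite [X in X + _]big_nat_recl // -addrA -big_split /=; congr (_ + _).
  by rewrite subn0 addn0 /W; ring.
apply: eq_big_nat => k /andP[_ kn].
rewrite -/(W k.+1) subSS (_ : ((3 * n).+2 + k.+1 = 3 * n + 3 + k)%N); last by lia.
ring.
Qed.

Lemma cubic_expansion_sym q x n : x != 0 ->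
  qpoch (q * x) (q ^+ 3) n * qpoch (q ^+ 2 / x) (q ^+ 3) n
  + qpoch (q ^+ 2 * x) (q ^+ 3) n * qpoch (q / x) (q ^+ 3) n
  = \sum_(0 <= k < n.+1)
      q ^+ (k ^ 2) * (1 + q ^+ k) * cubic_coef q n k
      * (qpoch x q k * qpoch x^-1 q k).
Proof.
move=> x0.
have := cubic_expansion q n (invr_neq0 x0); rewrite invrK => E.
rewrite [X in _ + X]mulrC E cubic_expansion // -big_split /=.
(* At index k + 1 the common factor (qx, q/x; q)_k is exposed on both sides, which avoids dividing
   by 1 - x, possibly zero. *)
apply: eq_big_nat => -[|k] _; first by rewrite !qpoch0; ring.
rewrite (qpochSl x q k) (qpochSl x^-1 q k) (qpochS (q / x)) (qpochS (q * x)).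
rewrite (mulrC x q) (mulrC x^-1 q).
by rewrite exprS; field.
Qed.

(** Trades the ratio (q^(-3n); q^3)_k / (q^(-3n); q)_k of the left-hand side for the closed form in
    [cubic_coefE]. *)
Lemma cubic_base_change q n k : q != 0 -> (k <= n)%N ->
  q ^+ (k ^ 2) * qpoch (q ^- (3 * n)) q k
    * (qpoch q (q ^+ 3) (n - k) * qpoch (q ^+ 2) (q ^+ 3) (n - k)
       * qpoch (q ^+ (3 * (n - k)).+1) q (2 * k))
  = q ^+ k * qpoch (q ^- (3 * n)) (q ^+ 3) k
    * (qpoch q (q ^+ 3) n * qpoch (q ^+ 2) (q ^+ 3) n).
Proof.
move=> q0; elim: k => [|k IH] kn; first by rewrite !qpoch0 subn0; ring.
move: (IH (ltnW kn)).
have [m Em] : exists m, (n - k = m.+1)%N by exists (n - k).-1; lia.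
rewrite (_ : (n - k.+1 = m)%N) ?Em; last by lia.
have -> : (2 * k.+1 = (2 * k).+2)%N by lia.
have T := qpoch_triple q Em.
(* The reversal 1 - q^(-a) = - q^(-a) (1 - q^a) brings out the factors that occur in
   [qpoch_triple]. *)
have F1 : 1 - q ^- (3 * n) * q ^+ k = - (q ^- (3 * n) * q ^+ k) * (1 - q ^+ (3 * n - k)).
  have -> : q ^+ (3 * n) = q ^+ (3 * n - k) * q ^+ k by rewrite -exprD subnK //; lia.
  by field; rewrite !expf_neq0.
have F2 : 1 - q ^- (3 * n) * q ^+ 3 ^+ k
    = - (q ^- (3 * n) * q ^+ k ^+ 3) * (1 - q ^+ (3 * m.+1)).
  have -> : q ^+ (3 * n) = q ^+ (3 * m.+1) * q ^+ k ^+ 3.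
    by rewrite -exprM -exprD; congr (_ ^+ _); lia.
  by rewrite (exprAC q 3 k); field; rewrite !expf_neq0.
have -> : (k.+1 ^ 2 = (k ^ 2 + k + k).+1)%N by lia.
rewrite !(qpochS _ _ k) !(qpochS _ _ m) F1 F2 => H.
rewrite [LHS](_ : _ = q ^+ (k ^ 2 + k + k).+1 * qpoch (q ^- (3 * n)) q k
   * - (q ^- (3 * n) * q ^+ k) * (qpoch q (q ^+ 3) m * qpoch (q ^+ 2) (q ^+ 3) m)
   * (qpoch (q ^+ (3 * m).+1) q (2 * k).+2 * (1 - q ^+ (3 * n - k)))); last by ring.
rewrite T.
rewrite [RHS](_ : _ = (q ^+ k * qpoch (q ^- (3 * n)) (q ^+ 3) k *
    (qpoch q (q ^+ 3) n * qpoch (q ^+ 2) (q ^+ 3) n)) *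
    (q * - (q ^- (3 * n) * q ^+ k ^+ 3) * (1 - q ^+ (3 * m.+1)))); last by rewrite exprS; ring.
rewrite -H -!exprM !exprS !exprD.
have -> : q ^+ (k * 3) = q ^+ k * q ^+ k * q ^+ k by rewrite -!exprD; congr (_ ^+ _); lia.
ring.
Qed.

(** * Connection coefficients *)

(** Converts (q^(1/2-l); q)_k into (q^(1/2); q)_k; the product over j is the k-dependent common
    factor of [connection_formula]. Raising l divides the parameter by q, so [qpoch_shift] trades
    one end factor for the other. *)
Lemma qpoch_half_shift s k l : s != 0 ->
  qpoch (s * s ^- (2 * l)) (s ^+ 2) k
    * \prod_(0 <= j < l) (s ^+ 2 ^+ k - s * s ^+ 2 ^+ j)
  = qpoch s (s ^+ 2) k * qpoch s (s ^+ 2) l.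
Proof.
move=> s0; elim: l => [|l IH].
  by rewrite big_geq // muln0 expr0 invr1 qpoch0 !mulr1.
rewrite big_nat_recr //= qpochS [in RHS]mulrA -IH.
have e : s * s ^- (2 * l) = s * s ^- (2 * l.+1) * s ^+ 2.
  rewrite (_ : (2 * l.+1 = 2 + 2 * l)%N); last by lia.
  by rewrite exprD; field; rewrite !expf_neq0.
have := qpoch_shift (s * s ^- (2 * l.+1)) (s ^+ 2) k; rewrite -e => E.
have e1 : s ^+ 2 ^+ k - s * s ^+ 2 ^+ l
    = - (s * s ^+ 2 ^+ l) * (1 - s * s ^- (2 * l.+1) * s ^+ 2 ^+ k).
  by rewrite [s ^+ (2 * l.+1)]exprM [_ ^+ l.+1]exprS; field; rewrite s0 !expf_neq0.
rewrite e1 [LHS](_ : _ = - (s * s ^+ 2 ^+ l) * \prod_(0 <= j < l) (s ^+ 2 ^+ k - s * s ^+ 2 ^+ j) *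
  (qpoch (s * s ^- (2 * l.+1)) (s ^+ 2) k * (1 - s * s ^- (2 * l.+1) * s ^+ 2 ^+ k))); last by ring.
by rewrite E [s ^+ (2 * l.+1)]exprM [_ ^+ l.+1]exprS; field; rewrite s0 !expf_neq0.
Qed.

(* s stands for q^(1/2). *)
Definition connection_coef s x l i : F :=
  s ^+ ((2 * l + 1) * i) * ((1 + x * s ^+ 2 ^+ i) / (1 + x)) *
  (qpoch (s ^+ 2 ^- l) (s ^+ 2) i * qpoch (x ^+ 2) (s ^+ 2) i /
   (qpoch (s ^+ 2) (s ^+ 2) i * qpoch (x ^+ 2 * s ^+ 2 ^+ l.+1) (s ^+ 2) i)).

Lemma connection_coef0 s x l : 1 + x != 0 -> connection_coef s x l 0 = 1.
Proof.
by move=> x1; rewrite /connection_coef !qpoch0 muln0 !expr0; field; rewrite oner_neq0.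
Qed.

Lemma connection_coef_gt s x l : s != 0 -> connection_coef s x l l.+1 = 0.
Proof.
move=> s0; rewrite /connection_coef (qpochS (_ ^- _)) mulVf ?expf_neq0 //.
by rewrite subrr !(mulr0, mul0r).
Qed.

(** Being independent of i, this factor lets the recurrence in l pass from coefficients to whole
    sums. *)
Definition connection_step s x l : F :=
  s ^+ (2 * l + 1) * (1 - x) * (1 + x * s ^+ 2) * (1 - x ^+ 2 * s ^+ 2) /
    ((1 - x ^+ 2 * s ^+ 2 ^+ l.+1) * (1 - x ^+ 2 * s ^+ 2 ^+ l.+2)).

(** All three terms share (q^-l, x^2 q^2; q)_i / (q, x^2 q^(l+3); q)_i; what remains is a rational
    identity in x, s, q^l and q^i. *)
Lemma connection_coef_rec s x l i :
  s != 0 -> 1 + x != 0 -> (i <= l)%N ->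
  (forall j, (j <= l)%N -> 1 - s ^+ 2 ^+ j.+1 != 0) ->
  (forall j, (j < 2 * l.+1)%N -> 1 - x ^+ 2 * s ^+ 2 ^+ j.+1 != 0) ->
  connection_coef s x l.+1 i.+1
  = connection_coef s x l i.+1
    - connection_step s x l * connection_coef s (x * s ^+ 2) l i.
Proof.
move=> s0 x1 il hs hx.
have q0 : s ^+ 2 != 0 by rewrite expf_neq0.
rewrite /connection_coef /connection_step; move eq_q : (s ^+ 2) => q.
rewrite eq_q in q0 hs hx.
have xq1 : 1 + x * q != 0.
  have := hx 1%N (ltac:(lia)); apply: contra_neq => E.
  rewrite [LHS](_ : _ = (1 + x * q) * (1 - x * q)); last by ring.
  by rewrite E mul0r.
set a := x ^+ 2.
have -> : (x * q) ^+ 2 = a * q ^+ 2 by rewrite exprMn.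
have -> : a * q ^+ 2 * q ^+ l.+1 = a * q ^+ l.+3 by rewrite -mulrA -exprD.
have pq : q ^- l = q ^- l.+1 * q by rewrite exprS; field; rewrite expf_neq0.
rewrite (qpochSl (q ^- l.+1)) -pq (qpochS (q ^- l)) (qpochSl a) (qpochS q).
have E1 := qpoch_shift (a * q) q i.
have E2 := qpoch_shift (a * q ^+ l.+2) q i.
rewrite (qpochSl (a * q ^+ l.+1)).
have -> : a * q ^+ l.+1 * q = a * q ^+ l.+2 by rewrite -mulrA -exprSr.
rewrite (qpochS (a * q ^+ l.+2)).
rewrite -[a * q * q]mulrA -expr2 in E1.
rewrite -[a * q ^+ l.+2 * q]mulrA -exprSr in E2.
have n1 : 1 - a * q * q ^+ i != 0 by rewrite -mulrA -exprS; apply: hx; move: il; clear; lia.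
have n2 : 1 - a * q ^+ l.+2 * q ^+ i != 0.
  by rewrite -mulrA -exprD addSn; apply: hx; move: il; clear; lia.
have n3 : 1 - a * q ^+ l.+2 != 0 by apply: hx; move: il; clear; lia.
have n4 : 1 - a * q ^+ l.+1 != 0 by apply: hx; move: il; clear; lia.
have n5 : 1 - q * q ^+ i != 0 by rewrite -exprS; apply: hs.
have n6 : 1 - q ^+ l.+1 != 0 by apply: hs.
have D0 : qpoch (a * q ^+ l.+3) q i != 0.
  by apply: qpoch_neq0P => j ji; rewrite -mulrA -exprD addSn; apply: hx; move: il ji; clear; lia.
have C0 : qpoch q q i != 0.
  by apply: qpoch_neq0P => j ji; rewrite -exprS; apply: hs; move: il ji; clear; lia.
have -> : qpoch (a * q) q i = (1 - a * q) * qpoch (a * q ^+ 2) q i / (1 - a * q * q ^+ i).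
  by rewrite -E1 mulfK.
have -> : qpoch (a * q ^+ l.+2) q i =
    (1 - a * q ^+ l.+2) * qpoch (a * q ^+ l.+3) q i / (1 - a * q ^+ l.+2 * q ^+ i).
  by rewrite -E2 mulfK.
have -> : s ^+ ((2 * l.+1 + 1) * i.+1) =
    s ^+ ((2 * l + 1) * i) * (s * q ^+ l) * (q * q ^+ i).
  by rewrite -eq_q -!exprM -!exprD -exprS -!exprD; congr (_ ^+ _); clear; lia.
have -> : s ^+ ((2 * l + 1) * i.+1) = s ^+ ((2 * l + 1) * i) * (s * q ^+ l).
  by rewrite -eq_q -!exprM -exprS -!exprD; congr (_ ^+ _); clear; lia.
have -> : s ^+ (2 * l + 1) = s * q ^+ l.
  by rewrite -eq_q -!exprM -exprS; congr (_ ^+ _); clear; lia.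
rewrite !exprS expr0 mulr1 in n1 n2 n3 n4 n5 n6 D0 *.
have v0 : q ^+ l != 0 by rewrite expf_neq0.
rewrite {}/a in n1 n2 n3 n4 D0 E1 E2 *.
clear E1 E2 pq hs hx.
move: D0 C0 v0 n1 n2 n3 n4 n5 n6.
move: (qpoch (_ * (q * (q * (q * _)))) q i) => D D0.
move: (qpoch q q i) => C C0.
move: (qpoch (q ^- l) q i) => A.
move: (qpoch _ q i) => M.
move: (s ^+ ((2 * l + 1) * i)) => S.
move: (q ^+ l) (q ^+ i) => v u.
move=> v0 n1 n2 n3 n4 n5 n6.
by field; rewrite D0 C0 xq1 n3 n4 n2 n5 n1 v0 x1 q0.
Qed.

(** A factor 1 - y divides 1 - y^2, and y^2 runs over x^2 q^m with 1 <= m <= 2l, m even for the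
    first symbol and odd for the second. *)
Lemma qpoch_sqrt_neq0 s x l :
  (forall j, (j < 2 * l)%N -> 1 - x ^+ 2 * s ^+ 2 ^+ j.+1 != 0) ->
  (qpoch (s ^+ 2 * x) (s ^+ 2) l != 0) /\ (qpoch (s * x) (s ^+ 2) l != 0).
Proof.
move=> hx.
have sq_neq0 y j : y ^+ 2 = x ^+ 2 * s ^+ 2 ^+ j.+1 -> (j < 2 * l)%N -> 1 - y != 0.
  move=> Ey jl; have := hx j jl; rewrite -Ey; apply: contra_neq => /subr0_eq <-.
  by rewrite expr1n subrr.
split; apply: qpoch_neq0P => j jl.
- apply: (sq_neq0 _ (2 * j).+1); last by move: jl; clear; lia.
  by rewrite [_ ^+ (2 * j).+2]exprS [_ ^+ (2 * j).+1]exprS (mulnC 2 j) exprM; ring.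
- apply: (sq_neq0 _ (2 * j)%N); last by move: jl; clear; lia.
  by rewrite [_ ^+ (2 * j).+1]exprS (mulnC 2 j) exprM; ring.
Qed.

Lemma connection_formula s x k l :
  s != 0 -> x != 0 -> 1 + x != 0 ->
  (forall j, (j < l)%N -> 1 - s ^+ 2 ^+ j.+1 != 0) ->
  (forall j, (j < 2 * l)%N -> 1 - x ^+ 2 * s ^+ 2 ^+ j.+1 != 0) ->
  \sum_(0 <= i < l.+1) connection_coef s x l i *
     (qpoch (x * s ^+ 2 ^+ i) (s ^+ 2) k * qpoch (s ^+ 2 ^- i / x) (s ^+ 2) k)
  = qpoch x (s ^+ 2) k * qpoch (s ^+ 2 ^- l / x) (s ^+ 2) k
    * (qpoch (s ^+ 2 * x ^+ 2) (s ^+ 2) l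
       / (qpoch (s ^+ 2 * x) (s ^+ 2) l * qpoch (s * x) (s ^+ 2) l))
    * \prod_(0 <= j < l) (s ^+ 2 ^+ k - s * s ^+ 2 ^+ j).
Proof.
move=> s0; elim: l x => [|l IH] x x0 x1 hs hx.
  by rewrite big_nat1 big_geq // connection_coef0 // expr0 invr1 !qpoch0 !mulr1 !mul1r invr1 mulr1.
have q0 : s ^+ 2 != 0 by rewrite expf_neq0.
have pxq : 1 + x * s ^+ 2 != 0.
  have := hx 1%N (ltac:(lia)); apply: contra_neq => /addr0_eq E.
  by rewrite -exprMn -E sqrrN expr1n subrr.
rewrite [in LHS]big_nat_recl // connection_coef0 // mul1r.
set w := fun i => qpoch (x * s ^+ 2 ^+ i) (s ^+ 2) k
                  * qpoch (s ^+ 2 ^- i / x) (s ^+ 2) k.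
(* Passing from x to x q shifts the node index by one, so the two sums of order l cover the nodes
   0..l and 1..l+1. *)
have wS i : qpoch (x * s ^+ 2 * s ^+ 2 ^+ i) (s ^+ 2) k
    * qpoch (s ^+ 2 ^- i / (x * s ^+ 2)) (s ^+ 2) k = w i.+1.
  rewrite /w [_ ^+ i.+1]exprS mulrA; congr (_ * qpoch _ _ _).
  by field; rewrite s0 x0 !expf_neq0.
transitivity (\sum_(0 <= i < l.+1) connection_coef s x l i * w i
  - connection_step s x l *
    \sum_(0 <= i < l.+1) connection_coef s (x * s ^+ 2) l i * w i.+1).
  (* The added term i = l + 1 vanishes since (q^-l; q)_{l+1} = 0. *)
  rewrite (_ : \sum_(0 <= i < l.+1) connection_coef s x l i * w i =
     \sum_(0 <= i < l.+2) connection_coef s x l i * w i); last first.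
    by rewrite [RHS]big_nat_recr //= connection_coef_gt // mul0r addr0.
  rewrite [in RHS]big_nat_recl // connection_coef0 // mul1r -addrA; congr (_ + _).
  rewrite big_distrr /= -sumrB; apply: eq_big_nat => i /andP[_ il].
  by rewrite connection_coef_rec // -/(w i.+1) mulrBl mulrA.
rewrite IH //; first last.
- by move=> j jl; apply: hx; move: jl; clear; lia.
- by move=> j jl; apply: hs; move: jl; clear; lia.
rewrite (eq_bigr _ (fun i _ => congr1 _ (esym (wS i)))) IH //; first last.
(* At x q every exponent rises by 2, exactly what the bound [2 * l] gains from l to l + 1. *)
- move=> j jl; rewrite exprMn -mulrA -!exprM -exprD.
  have := hx j.+2; rewrite -exprM (_ : (2 * 2 + 2 * j.+1 = 2 * j.+3)%N); last by clear; lia.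
  by apply; move: jl; clear; lia.
- by move=> j jl; apply: hs; move: jl; clear; lia.
- by rewrite mulf_neq0.
rewrite big_nat_recr //=.
have E1 := qpoch_shift x (s ^+ 2) k.
have E2 := qpoch_shift (s ^+ 2 ^- l.+1 / x) (s ^+ 2) k.
have E3 := qpoch_shift (s ^+ 2 * x) (s ^+ 2) l.
have E4 := qpoch_shift (s * x) (s ^+ 2) l.
have E5 := qpoch_shift (s ^+ 2 * x ^+ 2) (s ^+ 2) l.
have E6 := qpoch_shift (s ^+ 2 * x ^+ 2 * s ^+ 2) (s ^+ 2) l.
have b1 : s ^+ 2 ^- l / (x * s ^+ 2) = s ^+ 2 ^- l.+1 / x.
  by rewrite [_ ^+ l.+1]exprS; field; rewrite s0 x0 !expf_neq0.
have b2 : s ^+ 2 ^- l.+1 / x * s ^+ 2 = s ^+ 2 ^- l / x.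
  by rewrite [_ ^+ l.+1]exprS; field; rewrite s0 x0 !expf_neq0.
have [/qpoch_neq0 N /qpoch_neq0 K] := qpoch_sqrt_neq0 hx.
have N0 : qpoch (s ^+ 2 * x) (s ^+ 2) l != 0.
  by apply: qpoch_neq0P => j jl; apply/N/ltnW.
have K0 : qpoch (s * x) (s ^+ 2) l != 0.
  by apply: qpoch_neq0P => j jl; apply/K/ltnW.
have n1 : 1 - s ^+ 2 * x != 0 by have := N 0 isT; rewrite expr0 mulr1.
have k1 : 1 - s * x != 0 by have := K 0 isT; rewrite expr0 mulr1.
have {N} nl := N l (ltnSn l); have {K} kl := K l (ltnSn l).
have a1 : 1 - s ^+ 2 * x ^+ 2 != 0 by rewrite mulrC; apply: (hx 0).
have a2 : 1 - s ^+ 2 * x ^+ 2 * s ^+ 2 != 0.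
  by rewrite [_ * s ^+ 2](_ : _ = x ^+ 2 * s ^+ 2 ^+ 2); first (apply: (hx 1%N); clear; lia); ring.
have a3 : 1 - x ^+ 2 * s ^+ 2 ^+ l.+1 != 0 by apply: hx; clear; lia.
have a4 : 1 - x ^+ 2 * s ^+ 2 ^+ l.+2 != 0 by apply: hx; clear; lia.
have v0 : s ^+ 2 ^+ l != 0 by rewrite expf_neq0.
rewrite b2 in E2; rewrite b1 !(qpochS _ _ l).
have -> : s ^+ 2 * (x * s ^+ 2) ^+ 2 = s ^+ 2 * x ^+ 2 * s ^+ 2 * s ^+ 2 by ring.
rewrite (mulrA (s ^+ 2) x) (mulrA s x).
(* The factor 1 - x is split off so that it merges with (xq; q)_k into (x; q)_k (1 - x q^k), without
   division when x = 1. *)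
have -> : connection_step s x l = s * s ^+ 2 ^+ l * (1 + x * s ^+ 2) * (1 - x ^+ 2 * s ^+ 2)
    / ((1 - x ^+ 2 * s ^+ 2 ^+ l.+1) * (1 - x ^+ 2 * s ^+ 2 ^+ l.+2)) * (1 - x).
  by rewrite /connection_step exprD expr1 exprM; field; rewrite a3 a4.
rewrite -[X in _ - X]mulrA !(mulrA (1 - x)) -E1.
have bE : s ^+ 2 ^- l.+1 / x = (s ^+ 2 * x * s ^+ 2 ^+ l)^-1.
  by rewrite [_ ^+ l.+1]exprS; field; rewrite s0 x0 v0.
rewrite bE in E2 *.
have b0 : 1 - (s ^+ 2 * x * s ^+ 2 ^+ l)^-1 != 0.
  apply: contra_neq nl => /subr0_eq E; by rewrite -[_ * _ ^+ l]invrK -E invr1 subrr.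
(* Each shifted symbol is solved for in terms of the unshifted one; the goal is then rational in six
   atoms, q^k and q^l. *)
rewrite [qpoch (s ^+ 2 ^- l / x) _ _](canRL (mulKf b0) (esym E2)).
rewrite [qpoch (s ^+ 2 * x * s ^+ 2) _ _](canRL (mulKf n1) (esym E3)).
rewrite [qpoch (s * x * s ^+ 2) _ _](canRL (mulKf k1) (esym E4)).
rewrite [qpoch (s ^+ 2 * x ^+ 2 * s ^+ 2 * s ^+ 2) _ _](canRL (mulKf a2) (esym E6)).
rewrite [qpoch (s ^+ 2 * x ^+ 2 * s ^+ 2) _ _](canRL (mulKf a1) (esym E5)).
move: N0 K0 a3 a4; rewrite [_ ^+ l.+2]exprS [_ ^+ l.+1]exprS.
move: (qpoch x _ _) (qpoch (_ ^- 1) _ _) (\prod_(0 <= j < l) _) (qpoch (_ * x ^+ 2) _ _)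
   (qpoch (_ ^+ 2 * x) _ _) (qpoch (s * x) _ _) => X B V P N K.
move: v0 nl kl b0; move: (s ^+ 2 ^+ l) (s ^+ 2 ^+ k) => v u v0 nl kl b0 N0 K0 a3 a4.
have b2' : s ^+ 2 * x * v - 1 != 0 by rewrite -opprB oppr_eq0.
have a1' : 1 - (s * x) ^+ 2 != 0 by rewrite exprMn.
have a2' : 1 - (s * x * s) ^+ 2 != 0 by rewrite !exprMn.
by field; rewrite a1' a2' a3 a4 n1 k1 nl kl b2' N0 K0 v0 s0 x0.
Qed.

(** * Assembly of the two expansions *)

(** Up to the factor 2 (q, q^2; q^3)_n, this matches the weight of the k-th left-hand term with its
    coefficient in [cubic_expansion_sym]. *)
Lemma cubic_term s n k : s != 0 -> (k <= n)%N ->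
  2 * (s ^+ 2 ^+ k * qpoch (s ^+ 2 ^- (3 * n)) (s ^+ 2 ^+ 3) k
    * (qpoch (s ^+ 2) (s ^+ 2 ^+ 3) n * qpoch (s ^+ 2 ^+ 2) (s ^+ 2 ^+ 3) n))
  = s ^+ 2 ^+ (k ^ 2) * (1 + s ^+ 2 ^+ k) * cubic_coef (s ^+ 2) n k
    * (qpoch (s ^+ 2) (s ^+ 2) k * qpoch (-1) (s ^+ 2) k * qpoch (- s) (s ^+ 2) k
       * qpoch s (s ^+ 2) k * qpoch (s ^+ 2 ^- (3 * n)) (s ^+ 2) k).
Proof.
move=> s0 kn; rewrite -cubic_base_change ?expf_neq0 // -cubic_coefE //.
rewrite [LHS](_ : _ = s ^+ 2 ^+ (k ^ 2) * qpoch (s ^+ 2 ^- (3 * n)) (s ^+ 2) k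
  * cubic_coef (s ^+ 2) n k * (2 * qpoch (s ^+ 2) (s ^+ 2) (2 * k))); last by ring.
by rewrite -qpoch_double; ring.
Qed.

End QPochhammer.

Theorem theorem11 (R : realType) (q sq : R[i]) (l n : nat) (x : R[i])
  (sqE : sq ^+ 2 = q)
  (q_neq0 : q != 0)
  (x_neq0 : x != 0)
  (x1_neq0 : 1 + x != 0)
  (denL : forall k : nat, (k <= n)%N ->
     qpochs [:: q; -1; sq ^ (1 - 2 * l%:Z); - sq; q ^ (- 3 * n%:Z)] q k != 0)
  (denRl : qpochs [:: q * x ^+ 2; sq] q l != 0)
  (denRi : forall i : nat, (i <= l)%N ->
     qpochs [:: q; x ^+ 2 * q ^+ l.+1] q i != 0)
  (denRn : qpochs [:: q; q ^+ 2] (q ^+ 3) n != 0) :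
  \sum_(0 <= k < n.+1)
     qpoch (q ^ (- 3 * n%:Z)) (q ^+ 3) k *
     qbracket [:: x; q ^ (- l%:Z) / x]
              [:: q; -1; sq ^ (1 - 2 * l%:Z); - sq; q ^ (- 3 * n%:Z)] q k *
     q ^+ k
  = qbracket [:: q * x; sq * x] [:: q * x ^+ 2; sq] q l *
    \sum_(0 <= i < l.+1)
       sq ^+ ((2 * l + 1) * i) * ((1 + x * q ^+ i) / (2 * (1 + x))) *
       qbracket [:: q ^ (- l%:Z); x ^+ 2] [:: q; x ^+ 2 * q ^+ l.+1] q i *
       (qbracket [:: q ^+ i.+1 * x; q ^ (2 - i%:Z) / x]
                 [:: q; q ^+ 2] (q ^+ 3) n +
        qbracket [:: q ^+ i.+2 * x; q ^ (1 - i%:Z) / x]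
                 [:: q; q ^+ 2] (q ^+ 3) n).
Proof.
have sq0 : sq != 0 by move: q_neq0; rewrite -sqE expf_eq0.
have e1 : sq ^ (1 - 2 * l%:Z) = sq * sq ^- (2 * l).
  by rewrite expfzDr // expr1z -exprnN.
have e2 : q ^ (- 3 * n%:Z) = q ^- (3 * n) by rewrite exprnN; congr (_ ^ _); lia.
have e3 : q ^ (- l%:Z) = q ^- l by rewrite -exprnN.
rewrite e1 e2 e3 {e1 e2 e3} in denL *.
have e4 i : q ^ (2 - i%:Z) / x = q ^+ 2 / (x * q ^+ i).
  by rewrite expfzDr // -exprnN; field; rewrite x_neq0 expf_neq0.
have e5 i : q ^ (1 - i%:Z) / x = q / (x * q ^+ i).
  by rewrite expfzDr // -exprnN expr1z; field; rewrite x_neq0 expf_neq0.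
move: denRl denRn; rewrite !qpochs2 !mulf_eq0 !negb_or.
move=> /andP[P0 S0] /andP[N1 N2].
have hs j : (j < l)%N -> 1 - q ^+ j.+1 != 0.
  move=> jl; have := denRi l (leqnn l); rewrite qpochs2 mulf_eq0 negb_or.
  by move=> /andP[/qpoch_neq0 H _]; rewrite exprS; apply: H.
(* Exponents 1..l come from (q x^2; q)_l, and l+1..2l from (x^2 q^(l+1); q)_i at i = l. *)
have hx j : (j < 2 * l)%N -> 1 - x ^+ 2 * q ^+ j.+1 != 0.
  move=> jl; have [jl'|lj] := ltnP j l.
    by rewrite [q ^+ _]exprS mulrA [x ^+ 2 * q]mulrC; apply: (qpoch_neq0 P0).
  have := denRi l (leqnn l); rewrite qpochs2 mulf_eq0 negb_or.
  move=> /andP[_ /qpoch_neq0 H]; rewrite (_ : j.+1 = l.+1 + (j - l))%N; last by lia.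
  by rewrite exprD mulrA; apply: H; lia.
subst q.
pose q : R[i] := sq ^+ 2; pose N := qpoch q (q ^+ 3) n * qpoch (q ^+ 2) (q ^+ 3) n.
have N0 : N != 0 by rewrite mulf_neq0.
pose w i k := qpoch (x * q ^+ i) q k * qpoch (q ^- i / x) q k.
pose g k := q ^+ (k ^ 2) * (1 + q ^+ k) * cubic_coef q n k.
pose Q := qbracket [:: q * x; sq * x] [:: q * x ^+ 2; sq] q l.
pose c i := connection_coef sq x l i.
(* [Q] times the k-independent ratio in [connection_formula] is 1 / (sq; q)_l. By [qpoch_half_shift]
   the product over j then leaves (sq; q)_k / (q^(1/2-l); q)_k, whose numerator is absorbed by
   [cubic_term]. *)
transitivity (Q * \sum_(0 <= i < l.+1) \sum_(0 <= k < n.+1) g k / (2 * N) * (c i * w i k)).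
  rewrite exchange_big_nat big_distrr /=; apply: eq_big_nat => k /andP[_ kn].
  rewrite -big_distrr /= connection_formula //.
  have := denL k kn; rewrite /Q /qbracket !qpochs2 /qpochs !big_cons big_nil !mulr1 -/q.
  rewrite !mulf_eq0 !negb_or => /and5P[a0 b0 c0 d0 e0].
  have [X0 Y0] := qpoch_sqrt_neq0 hx.
  rewrite (canRL (mulKf c0) (qpoch_half_shift k l sq0)) -/q.
  have u0 : q ^+ k != 0 by rewrite expf_neq0.
  have -> : qpoch (q ^- (3 * n)) (q ^+ 3) k = g k / (2 * N)
     * (qpoch q q k * qpoch (-1) q k * qpoch (- sq) q k * qpoch sq q k
        * qpoch (q ^- (3 * n)) q k) / q ^+ k.
    rewrite -[g k / _ * _]mulrAC -(@cubic_term _ sq n k) // -/q -/N.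
    by field; rewrite u0 N0.
  field. by rewrite u0 N0 a0 b0 c0 d0 e0 P0 S0 X0 Y0.
(* For fixed i the sum over k is S(x q^i), because w i k = (y, 1/y; q)_k with y = x q^i. *)
congr (_ * _); apply: eq_big_nat => i /andP[_ il].
rewrite e4 e5 /qbracket !qpochs2 -/q -/N -mulrDl.
have xq0 : x * q ^+ i != 0 by rewrite mulf_neq0 // expf_neq0.
have -> : q ^+ i.+1 * x = q * (x * q ^+ i) by rewrite exprS; ring.
have -> : q ^+ i.+2 * x = q ^+ 2 * (x * q ^+ i) by rewrite !exprS; ring.
rewrite cubic_expansion_sym // mulr_suml big_distrr /=; apply: eq_bigr => k _.
rewrite /g /c /w /connection_coef -/q [q ^- i / x](_ : _ = (x * q ^+ i)^-1); last first.
  by rewrite invfM mulrC.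
have C0 : qpoch q q i * qpoch (x ^+ 2 * q ^+ l.+1) q i != 0.
  by rewrite -qpochs2; apply: denRi.
move: C0; move: (qpoch q q i * _) => C C0.
field. by rewrite N0 C0 x1_neq0.
Qed.
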